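(* Let $m>0$, $0<k\leq 1$ and $0\leq\lambda<1$. Then the function $$\mathcal{F}(m,z)=z-\sum_{n=2}^{\infty}\frac{m^{n-1}}{(n-1)!}e^{-m}z^{n}$$ is in $\mathcal{S}(k,\lambda)$ if and only if $$\big((1-\lambda)+k(1+\lambda)\big)\,m e^{m}\leq 2k.$$
   Context: Let $\mathcal{U}=\{z\in\mathbb{C}:|z|<1\}$. Let $\mathcal{A}$ be the class of functions $f(z)=z+\sum_{n=2}^{\infty}a_nz^n$ analytic in $\mathcal{U}$, and let $\mathcal{T}$ be the subclass of $\mathcal{A}$ of functions of the form $f(z)=z-\sum_{n=2}^{\infty}|a_n|z^n$, $z\in\mathcal{U}$. For $0<k\leq1$ and $0\leq\lambda<1$, a function $f$ of the form $f(z)=z-\sum_{n=2}^{\infty}|a_n|z^n$ (i.e. $f\in\mathcal{T}$) is in $\mathcal{S}(k,\lambda)$ if $$\left|\frac{\frac{zf'(z)}{(1-\lambda)f(z)+\lambda zf'(z)}-1}{\frac{zf'(z)}{(1-\lambda)f(z)+\lambda zf'(z)}+1}\right|<k\qquad (z\in\mathcal{U}).$$ *)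

(* Defs.v *)
From Stdlib Require Import Reals Factorial.
From Coquelicot Require Import Coquelicot.

Open Scope R_scope.

Definition unit_disc (z : C) : Prop := Cmod z < 1.

(* [sums_from2 u l] : the series [u 2 + u 3 + ...] of complex numbers converges
   to [l]. *)
Definition sums_from2 (u : nat -> C) (l : C) : Prop :=
  @is_series C_AbsRing C_NormedModule (fun j => u (j + 2)%nat) l.

(* The value of the same series; only meaningful when it converges. *)
Definition sum_from2 (u : nat -> C) : C :=
  @iota C_CompleteNormedModule (sums_from2 u).

(* Functions are total on [C], but only their values on the open unit disc
   matter, including for the derivatives below, as the disc is open. *)
Definition analytic_in_disc (f : C -> C) : Prop :=
  forall z, unit_disc z -> @ex_derive C_AbsRing C_NormedModule f z.

Definition class_A (f : C -> C) : Prop :=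
  analytic_in_disc f /\
  exists a : nat -> C, forall z, unit_disc z ->
    sums_from2 (fun n => a n * z ^ n)%C (f z - z)%C.

Definition class_T (f : C -> C) : Prop :=
  class_A f /\
  exists a : nat -> C, forall z, unit_disc z ->
    sums_from2 (fun n => Cmod (a n) * z ^ n)%C (z - f z)%C.

Definition quot_den (lambda : R) (f : C -> C) (z : C) : C :=
  ((1 - lambda) * f z + lambda * (z * C_derive f z))%C.

(* The quotient z f'(z) / ((1 - lambda) f(z) + lambda z f'(z)). At z = 0 both
   numerator and denominator vanish; for f in [class_A] both are z + O(z^2), so
   the singularity is removable, with value 1. *)
Definition quot (lambda : R) (f : C -> C) (z : C) : C :=
  if Ceq_dec z 0 then 1%C else (z * C_derive f z / quot_den lambda f z)%C.

(* Division is total ([x / 0 = 0]), so that both quotients are defined is part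
   of the condition. *)
Definition class_S (k lambda : R) (f : C -> C) : Prop :=
  class_T f /\
  forall z, unit_disc z ->
    (z <> 0%C -> quot_den lambda f z <> 0%C) /\
    (quot lambda f z + 1)%C <> 0%C /\
    Cmod ((quot lambda f z - 1) / (quot lambda f z + 1))%C < k.

Definition poisson_F (m : R) (z : C) : C :=
  (z - sum_from2 (fun n =>
         RtoC (m ^ (n - 1) / INR (fact (n - 1)) * exp (- m)) * z ^ n))%C.

(* Main.v *)
Require Import Defs.
From Stdlib Require Import Reals Factorial Lia Lra.
From Coquelicot Require Import Coquelicot.
Open Scope R_scope.

(* Write F(z) = z p(z) with p(z) = 1 + e^(-m) - e^(m(z-1)), and put
   q(z) = m z e^(m(z-1)), so that z F'(z) = z (p - q). The quantity to be bounded
   is then (1 - lambda) |q| / |2 p - (1 + lambda) q|. On the disc |q| < m and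
   |p| > e^(-m), which gives sufficiency. On the segment [0, 1) the denominator
   2 p - (1 + lambda) q is real, does not vanish and is 2 at the origin, so it is
   positive; letting z tend to 1 there turns the bound into the inequality
   (1 - lambda) m <= k (2 e^(-m) - (1 + lambda) m). *)

(** * Complex series: domination, uniqueness of sums, real series *)

(** The triangle inequality gives the bound for partial sums, and it passes to the limit. *)
Lemma Cmod_is_series_le (a : nat -> C) (b : nat -> R) (l : C) (M : R) :
  (forall n, Cmod (a n) <= b n) ->
  @is_series C_AbsRing C_NormedModule a l -> is_series b M -> Cmod l <= M.
Proof.
intros Hab Ha Hb.
apply (filterlim_le (F := eventually) (fun n => Cmod (sum_n a n)) (sum_n b)
         (Cmod l) M).
- exists 0%nat. intros n _.
  eapply Rle_trans.
  + apply (norm_sum_n_m (K := C_AbsRing) (V := C_NormedModule) a 0 n).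
  + apply sum_n_m_le. exact Hab.
- apply (filterlim_comp _ _ _ (sum_n a) Cmod eventually (locally l)).
  + exact Ha.
  + apply (filterlim_norm (K := C_AbsRing) (V := C_NormedModule) l).
- exact Hb.
Qed.

Lemma is_series_C_unique (a : nat -> C) (l l' : C) :
  @is_series C_AbsRing C_NormedModule a l ->
  @is_series C_AbsRing C_NormedModule a l' -> l = l'.
Proof.
intros H H'.
apply (filterlim_locally_unique (K := C_AbsRing) (V := C_NormedModule)
         (F := eventually) (sum_n a) l l'); assumption.
Qed.

Lemma is_series_RtoC (a : nat -> R) (l : R) :
  is_series a l ->
  @is_series C_AbsRing C_NormedModule (fun n => RtoC (a n)) (RtoC l).
Proof.
intros H.
assert (E : forall n,
  @sum_n (AbelianGroup.AbelianMonoid C_NormedModule) (fun n => RtoC (a n)) n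
    = RtoC (sum_n a n)).
{ induction n as [|n IH].
  - now rewrite !sum_O.
  - rewrite !sum_Sn, IH. symmetry. apply RtoC_plus. }
apply (filterlim_ext (fun n => RtoC (sum_n a n))).
- intros n. symmetry. apply E.
- apply filterlim_locally. intros eps.
  generalize (proj1 (filterlim_locally _ _) H eps).
  apply filter_imp. intros n Hn.
  (* A ball in [C] is a product of balls of the two components, and all imaginary parts here are
     0. *)
  split; [exact Hn | apply ball_center].
Qed.

(** * The complex exponential: power series, bounds and derivative *)

Definition exp_coef (n : nat) : R := / INR (fact n).

Lemma exp_coef_pos (n : nat) : 0 < exp_coef n.
Proof. apply Rinv_0_lt_compat, INR_fact_lt_0. Qed.

Lemma exp_coef_S (n : nat) : exp_coef (S n) * INR (S n) = exp_coef n.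
Proof.
unfold exp_coef. rewrite fact_simpl, mult_INR. field.
split; [apply INR_fact_neq_0 | apply not_0_INR; lia].
Qed.

Lemma is_series_exp (x : R) : is_series (fun n => exp_coef n * x ^ n) (exp x).
Proof.
apply is_series_ext with (2 := is_exp_Reals x).
intros n. rewrite pow_n_pow. apply Rmult_comm.
Qed.

(** [iota] selects the sum; [is_series_Cexp] shows that it exists for every [w], so no default value
    occurs. *)
Definition Cexp (w : C) : C :=
  @iota C_CompleteNormedModule
    (@is_series C_AbsRing C_NormedModule (fun n => RtoC (exp_coef n) * w ^ n)%C).

Lemma Cmod_exp_term (w : C) (n : nat) :
  Cmod (RtoC (exp_coef n) * w ^ n)%C = exp_coef n * Cmod w ^ n.
Proof.
rewrite Cmod_mult, Cmod_R, Cmod_pow, Rabs_pos_eq; [reflexivity|].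
apply Rlt_le, exp_coef_pos.
Qed.

(** The moduli of the terms form the real exponential series at [Cmod w], so completeness of [C]
    gives a sum; by uniqueness, [iota] returns it. *)
Lemma is_series_Cexp (w : C) :
  @is_series C_AbsRing C_NormedModule (fun n => RtoC (exp_coef n) * w ^ n)%C
    (Cexp w).
Proof.
destruct (ex_series_le (K := C_AbsRing) (V := C_CompleteNormedModule)
  (fun n => RtoC (exp_coef n) * w ^ n)%C (fun n => exp_coef n * Cmod w ^ n))
  as [l Hl].
- intros n. apply Req_le. apply Cmod_exp_term.
- exists (exp (Cmod w)). apply is_series_exp.
- replace (Cexp w) with l; [exact Hl|].
  symmetry. apply (iota_unique (V := C_CompleteNormedModule)); [|exact Hl].
  intros y Hy. exact (is_series_C_unique _ _ _ Hy Hl).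
Qed.

Lemma Cmod_Cexp (w : C) : Cmod (Cexp w) <= exp (Cmod w).
Proof.
apply Cmod_is_series_le with (2 := is_series_Cexp w) (3 := is_series_exp _).
intros n. apply Req_le, Cmod_exp_term.
Qed.

Lemma Cexp_RtoC (x : R) : Cexp (RtoC x) = RtoC (exp x).
Proof.
apply is_series_C_unique with (1 := is_series_Cexp x).
apply is_series_ext with (2 := is_series_RtoC _ _ (is_series_exp x)).
intros n. now rewrite RtoC_mult, RtoC_pow.
Qed.

(* Every coefficient in the binomial expansion of the left-hand side is
   nonnegative, hence the majorization. *)
Lemma Cmod_pow_remainder (w h : C) (n : nat) :
  Cmod ((w + h) ^ S n - w ^ S n - RtoC (INR (S n)) * h * w ^ n)%C <=
  (Cmod w + Cmod h) ^ S n - Cmod w ^ S n - INR (S n) * Cmod h * Cmod w ^ n.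
Proof.
induction n as [|n IH].
- replace ((w + h) ^ 1 - w ^ 1 - RtoC (INR 1) * h * w ^ 0)%C with (RtoC 0).
  + rewrite Cmod_0. simpl. lra.
  + simpl. ring.
- set (D := ((w + h) ^ S n - w ^ S n - RtoC (INR (S n)) * h * w ^ n)%C) in IH.
  (* The remainders satisfy D(n+1) = (w + h) D(n) + (n + 1) h^2 w^n, in [C] as in [R]; its
     coefficients are nonnegative, so the bound propagates. *)
  replace ((w + h) ^ S (S n) - w ^ S (S n)
           - RtoC (INR (S (S n))) * h * w ^ S n)%C
    with ((w + h) * D + RtoC (INR (S n)) * (h * h) * w ^ n)%C.
  2:{ unfold D. rewrite (S_INR (S n)), RtoC_plus, !Cpow_S. ring. }
  eapply Rle_trans; [apply Cmod_triangle|].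
  rewrite !Cmod_mult, Cmod_R, Cmod_pow, Rabs_pos_eq by apply pos_INR.
  assert (H : Cmod (w + h) * Cmod D <= (Cmod w + Cmod h) *
     ((Cmod w + Cmod h) ^ S n - Cmod w ^ S n
      - INR (S n) * Cmod h * Cmod w ^ n)).
  { apply Rmult_le_compat; try apply Cmod_ge_0; [apply Cmod_triangle|exact IH]. }
  rewrite (S_INR (S n)).
  simpl pow in *. nra.
Qed.

(** The term h n x^(n-1) / n! of the differentiated exponential series: the shift by one aligns it
    with x^n / n!, and the index 0 contributes 0. *)
Definition exp_diff_term (n : nat) : R -> R -> R :=
  fun x h => match n with 0%nat => 0 | S j => h * (exp_coef j * x ^ j) end.

Definition Cexp_diff_term (n : nat) : C -> C -> C :=
  fun w h =>
    match n with 0%nat => 0%C | S j => (h * (RtoC (exp_coef j) * w ^ j))%C end.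

Lemma is_series_exp_diff (x h : R) :
  is_series (fun n => exp_diff_term n x h) (h * exp x).
Proof.
apply is_series_decr_1. cbn [exp_diff_term].
replace (plus _ _) with (scal h (exp x)).
- apply (is_series_scal h _ _ (is_series_exp x)).
- unfold scal, plus, opp; simpl; unfold mult; simpl. ring.
Qed.

Lemma is_series_Cexp_diff (w h : C) :
  @is_series C_AbsRing C_NormedModule (fun n => Cexp_diff_term n w h)
    (h * Cexp w)%C.
Proof.
apply is_series_decr_1. cbn [Cexp_diff_term].
replace (plus _ _) with (@scal C_AbsRing C_NormedModule h (Cexp w)).
- apply (is_series_scal (V := C_NormedModule) h _ _ (is_series_Cexp w)).
- change (h * Cexp w = h * Cexp w + - 0)%C. ring.
Qed.

(** Both remainders are sums of series, compared term by term through [Cmod_pow_remainder]. *)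
Lemma Cmod_Cexp_remainder (w h : C) :
  Cmod (Cexp (w + h) - Cexp w - h * Cexp w)%C <=
  exp (Cmod w + Cmod h) - exp (Cmod w) - Cmod h * exp (Cmod w).
Proof.
assert (HC := is_series_minus _ _ _ _
  (is_series_minus _ _ _ _ (is_series_Cexp (w + h)) (is_series_Cexp w))
  (is_series_Cexp_diff w h)).
assert (HR := is_series_minus _ _ _ _
  (is_series_minus _ _ _ _ (is_series_exp (Cmod w + Cmod h))
     (is_series_exp (Cmod w)))
  (is_series_exp_diff (Cmod w) (Cmod h))).
refine (Cmod_is_series_le _ _ _ _ _ HC HR).
intros n.
change (Cmod (RtoC (exp_coef n) * (w + h) ^ n - RtoC (exp_coef n) * w ^ n
              - Cexp_diff_term n w h)%C <=
  exp_coef n * (Cmod w + Cmod h) ^ n - exp_coef n * Cmod w ^ n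
  - exp_diff_term n (Cmod w) (Cmod h)).
destruct n as [|n]; cbn [Cexp_diff_term exp_diff_term].
- simpl. replace (_ - _ - _)%C with (RtoC 0) by ring. rewrite Cmod_0. lra.
(* In the term of index n + 1, the 1/n! of the derivative is written (n + 1)/(n + 1)!, so that 1/(n
   + 1)! factors out. *)
- rewrite <- !(exp_coef_S n), RtoC_mult.
  replace (RtoC (exp_coef (S n)) * (w + h) ^ S n - RtoC (exp_coef (S n)) * w ^ S n
     - h * (RtoC (exp_coef (S n)) * RtoC (INR (S n)) * w ^ n))%C
    with (RtoC (exp_coef (S n)) *
      ((w + h) ^ S n - w ^ S n - RtoC (INR (S n)) * h * w ^ n))%C by ring.
  rewrite Cmod_mult, Cmod_R, Rabs_pos_eq by apply Rlt_le, exp_coef_pos.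
  eapply Rle_trans.
  + apply Rmult_le_compat_l; [apply Rlt_le, exp_coef_pos|].
    apply Cmod_pow_remainder.
  + apply Req_le. ring.
Qed.

(* [C_NormedModule] and the module underlying [C_AbsRing] have the same norm but
   different uniform structures; differentiability does not see the latter. *)
Lemma is_derive_C_NormedModule (f : C -> C) (z l : C) :
  @is_derive C_AbsRing (AbsRing_NormedModule C_AbsRing) f z l <->
  @is_derive C_AbsRing C_NormedModule f z l.
Proof.
split; intros [_ H]; split; try exact H; apply is_linear_scal_l.
Qed.

(* By the majorization, the remainder at [w] is dominated by that of the real
   exponential at [Cmod w], with the increment [Cmod h]. *)
Lemma is_derive_Cexp (w : C) :
  @is_derive C_AbsRing (AbsRing_NormedModule C_AbsRing) Cexp w (Cexp w).
Proof.
split; [apply is_linear_scal_l|].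
intros x Hx.
rewrite <- (is_filter_lim_locally_unique (V := AbsRing_NormedModule C_AbsRing)
             w x Hx).
clear x Hx.
intros eps.
(* The radius for [eps] is the one given by the derivative of the real exponential at [Cmod w]. *)
destruct (is_derive_exp (Cmod w)) as [_ Hd].
destruct (Hd (Cmod w) (fun P H => H) eps) as [d Hd'].
exists d. intros y Hy.
change (Cmod (y - w)%C < d) in Hy.
change (Cmod (Cexp y - Cexp w - (y - w) * Cexp w)%C <= eps * Cmod (y - w)%C).
set (h := (y - w)%C) in *.
replace y with (w + h)%C by (unfold h; ring).
eapply Rle_trans; [apply Cmod_Cexp_remainder|].
assert (Hb : ball (Cmod w) d (Cmod w + Cmod h)).
{ change (Rabs (Cmod w + Cmod h - Cmod w) < d).
  replace (Cmod w + Cmod h - Cmod w) with (Cmod h) by ring.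
  rewrite Rabs_pos_eq; [exact Hy|apply Cmod_ge_0]. }
specialize (Hd' _ Hb).
change (Rabs (exp (Cmod w + Cmod h) - exp (Cmod w)
              - (Cmod w + Cmod h - Cmod w) * exp (Cmod w)) <=
        eps * Rabs (Cmod w + Cmod h - Cmod w)) in Hd'.
replace (Cmod w + Cmod h - Cmod w) with (Cmod h) in Hd' by ring.
rewrite (Rabs_pos_eq (Cmod h)) in Hd' by apply Cmod_ge_0.
eapply Rle_trans; [apply Rle_abs|exact Hd'].
Qed.

Lemma is_derive_Cmult_l (f : C -> C) (c z l : C) :
  @is_derive C_AbsRing (AbsRing_NormedModule C_AbsRing) f z l ->
  @is_derive C_AbsRing (AbsRing_NormedModule C_AbsRing)
    (fun x => c * f x)%C z (c * l)%C.
Proof.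
intros H.
assert (Hc := is_derive_const (K := C_AbsRing)
                (V := AbsRing_NormedModule C_AbsRing) c z).
assert (Hm := is_derive_mult (K := C_AbsRing) _ _ z _ _ Hc H Cmult_comm).
match type of Hm with is_derive _ _ ?d =>
  replace (c * l)%C with d; [exact Hm|] end.
change (0 * f z + c * l = c * l)%C. ring.
Qed.

(** * The function F in closed form, its derivative and its membership in T *)

(** Here e^(m(z-1)) is kept as the product of e^(-m) and [Cexp (RtoC m * z)], so that no addition
    law for [Cexp] is called for. *)
Definition poisson_p (m : R) (z : C) : C :=
  (1 + RtoC (exp (- m)) - RtoC (exp (- m)) * Cexp (RtoC m * z))%C.

Definition poisson_q (m : R) (z : C) : C :=
  (RtoC m * z * (RtoC (exp (- m)) * Cexp (RtoC m * z)))%C.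

(** Once z e^(-m) is factored out, there remains the exponential series at m z without its term of
    index 0; its index j + 1 corresponds to z^(j + 2). *)
Lemma poisson_sums (m : R) (z : C) :
  sums_from2 (fun n =>
      RtoC (m ^ (n - 1) / INR (fact (n - 1)) * exp (- m)) * z ^ n)%C
    (z - z * poisson_p m z)%C.
Proof.
unfold sums_from2.
replace (z - z * poisson_p m z)%C
  with (@scal C_AbsRing C_NormedModule (z * RtoC (exp (- m)))%C
          (Cexp (RtoC m * z) - 1)%C).
2:{ change ((z * RtoC (exp (- m))) * (Cexp (RtoC m * z) - 1)
            = z - z * poisson_p m z)%C. unfold poisson_p. ring. }
eapply is_series_ext.
2:{ apply (is_series_scal (V := C_NormedModule)). apply is_series_incr_1.
    replace (plus _ _) with (Cexp (RtoC m * z)).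
    - apply is_series_Cexp.
    - change (Cexp (RtoC m * z) = Cexp (RtoC m * z) - 1
              + RtoC (exp_coef 0) * 1)%C.
      unfold exp_coef. simpl. rewrite Rinv_1. ring. }
intros j.
change ((z * RtoC (exp (- m))) *
        (RtoC (exp_coef (S j)) * (RtoC m * z) ^ S j) =
        RtoC (m ^ (j + 2 - 1) / INR (fact (j + 2 - 1)) * exp (- m))
        * z ^ (j + 2))%C.
replace (j + 2 - 1)%nat with (S j) by lia.
replace (j + 2)%nat with (S (S j)) by lia.
rewrite Cpow_mult_l, (Cpow_S z (S j)).
unfold Rdiv, exp_coef. rewrite !RtoC_mult, RtoC_pow. ring.
Qed.

Lemma poisson_F_eq (m : R) (z : C) : poisson_F m z = (z * poisson_p m z)%C.
Proof.
unfold poisson_F, sum_from2.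
rewrite (iota_unique (V := C_CompleteNormedModule) _ (z - z * poisson_p m z)%C).
- ring.
- intros y Hy. exact (is_series_C_unique _ _ _ Hy (poisson_sums m z)).
- apply poisson_sums.
Qed.

(** Product rule for z p(z), with z p'(z) = - q(z). The computation takes place in the module of
    [C_AbsRing], where the product rule is stated, and is then transferred. *)
Lemma is_derive_poisson_F (m : R) (z : C) :
  @is_derive C_AbsRing C_NormedModule (poisson_F m) z
    (poisson_p m z - poisson_q m z)%C.
Proof.
apply is_derive_C_NormedModule.
apply is_derive_ext with (fun z : C_AbsRing => mult z (poisson_p m z)).
{ intros t. symmetry. apply poisson_F_eq. }
assert (Hm : @is_derive C_AbsRing (AbsRing_NormedModule C_AbsRing)
               (fun z : C => RtoC m * z)%C z (RtoC m)).
{ assert (H := is_derive_Cmult_l (fun z => z) (RtoC m) z 1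
                 (is_derive_id (K := C_AbsRing) z)).
  now rewrite Cmult_1_r in H. }
assert (HE := is_derive_comp (K := C_AbsRing)
                (V := AbsRing_NormedModule C_AbsRing) Cexp
                (fun z : C => RtoC m * z)%C z _ _ (is_derive_Cexp _) Hm).
assert (Hp : @is_derive C_AbsRing (AbsRing_NormedModule C_AbsRing)
               (poisson_p m) z
               (- (RtoC (exp (- m)) * (RtoC m * Cexp (RtoC m * z))))%C).
{ assert (Hs := is_derive_Cmult_l _ (RtoC (exp (- m))) _ _ HE).
  assert (Hc := is_derive_const (K := C_AbsRing)
                  (V := AbsRing_NormedModule C_AbsRing)
                  (1 + RtoC (exp (- m)))%C z).
  assert (H := is_derive_minus _ _ _ _ _ Hc Hs).
  match type of H with is_derive _ _ ?d =>
    replace (- (RtoC (exp (- m)) * (RtoC m * Cexp (RtoC m * z))))%C with d end.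
  - exact H.
  - change (0 - RtoC (exp (- m)) * (RtoC m * Cexp (RtoC m * z)) =
            - (RtoC (exp (- m)) * (RtoC m * Cexp (RtoC m * z))))%C. ring. }
assert (H := is_derive_mult (K := C_AbsRing) _ _ z _ _
               (is_derive_id z) Hp Cmult_comm).
match type of H with is_derive _ _ ?d =>
  replace (poisson_p m z - poisson_q m z)%C with d end.
- exact H.
- change (1 * poisson_p m z
          + z * - (RtoC (exp (- m)) * (RtoC m * Cexp (RtoC m * z)))
          = poisson_p m z - poisson_q m z)%C.
  unfold poisson_q. ring.
Qed.

Lemma C_derive_poisson_F (m : R) (z : C) :
  C_derive (poisson_F m) z = (poisson_p m z - poisson_q m z)%C.
Proof. apply is_C_derive_unique, is_derive_poisson_F. Qed.

Lemma poisson_F_class_T (m : R) : 0 < m -> class_T (poisson_F m).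
Proof.
intros hm. split; [split|].
- intros z _. eexists. apply is_derive_poisson_F.
- exists (fun n => - RtoC (m ^ (n - 1) / INR (fact (n - 1)) * exp (- m)))%C.
  intros z _. rewrite poisson_F_eq.
  replace (z * poisson_p m z - z)%C
    with (@opp C_NormedModule (z - z * poisson_p m z)%C).
  2:{ change (- (z - z * poisson_p m z) = z * poisson_p m z - z)%C. ring. }
  eapply is_series_ext; [|apply is_series_opp, poisson_sums].
  intros n.
  cbv beta.
  set (c := RtoC (_ * _)). change (- (c * z ^ (n + 2)) = - c * z ^ (n + 2))%C.
  ring.
- exists (fun n => RtoC (m ^ (n - 1) / INR (fact (n - 1)) * exp (- m)))%C.
  intros z _. rewrite poisson_F_eq.
  eapply is_series_ext; [|apply poisson_sums].
  (* As m > 0, the coefficients are nonnegative and equal their moduli. *)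
  intros n. cbv beta. rewrite Cmod_R, Rabs_pos_eq; [reflexivity|].
  apply Rmult_le_pos; [|apply Rlt_le, exp_pos].
  apply Rmult_le_pos; [apply pow_le; lra|].
  apply Rlt_le, Rinv_0_lt_compat, INR_fact_lt_0.
Qed.

(** * The quotient in terms of p and q, and tools for bounding it *)

Lemma poisson_p_RtoC (m r : R) :
  poisson_p m (RtoC r) = RtoC (1 + exp (- m) - exp (- m) * exp (m * r)).
Proof.
unfold poisson_p.
now rewrite <- RtoC_mult, Cexp_RtoC, <- RtoC_mult, <- RtoC_plus, <- RtoC_minus.
Qed.

Lemma poisson_q_RtoC (m r : R) :
  poisson_q m (RtoC r) = RtoC (m * r * (exp (- m) * exp (m * r))).
Proof.
unfold poisson_q.
now rewrite <- RtoC_mult, Cexp_RtoC, <- !RtoC_mult.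
Qed.

Lemma quot_den_poisson_F (m lambda : R) (z : C) :
  quot_den lambda (poisson_F m) z =
  (z * (poisson_p m z - RtoC lambda * poisson_q m z))%C.
Proof.
unfold quot_den. rewrite C_derive_poisson_F, poisson_F_eq. ring.
Qed.

Lemma poisson_den_0 (m lambda : R) :
  (poisson_p m 0 - RtoC lambda * poisson_q m 0)%C = 1%C.
Proof.
rewrite poisson_p_RtoC, poisson_q_RtoC, <- RtoC_mult, <- RtoC_minus.
f_equal. rewrite Rmult_0_r, exp_0. ring.
Qed.

(** The common factor z cancels; at the origin the right-hand side is 1/1, which agrees with the
    value assigned by [quot]. *)
Lemma quot_poisson_F (m lambda : R) (z : C) :
  (poisson_p m z - RtoC lambda * poisson_q m z)%C <> 0%C ->
  quot lambda (poisson_F m) z =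
  ((poisson_p m z - poisson_q m z)
   / (poisson_p m z - RtoC lambda * poisson_q m z))%C.
Proof.
intros Hd. unfold quot. destruct (Ceq_dec z 0) as [->|Hz].
(* With 1 in place of [lambda], this evaluates the numerator p - q at 0. *)
- assert (H1 := poisson_den_0 m 1). rewrite Cmult_1_l in H1.
  rewrite poisson_den_0, H1. field.
- rewrite quot_den_poisson_F, C_derive_poisson_F. field.
  split; assumption.
Qed.

(** Both follow from |e^(m(z-1))| <= e^(m(|z|-1)) < 1: adding e^(m(z-1)) to p gives 1 + e^(-m), and
    multiplying it by m z gives q. *)
Lemma poisson_p_q_bounds (m : R) (z : C) :
  0 < m -> unit_disc z ->
  exp (- m) < Cmod (poisson_p m z) /\ Cmod (poisson_q m z) < m.
Proof.
intros hm Hz. unfold unit_disc in Hz.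
assert (He : Cmod (RtoC (exp (- m)) * Cexp (RtoC m * z))%C < 1).
{ rewrite Cmod_mult, Cmod_R, Rabs_pos_eq by apply Rlt_le, exp_pos.
  apply Rle_lt_trans with (exp (- m) * exp (m * Cmod z)).
  - apply Rmult_le_compat_l; [apply Rlt_le, exp_pos|].
    replace (m * Cmod z) with (Cmod (RtoC m * z)%C); [apply Cmod_Cexp|].
    rewrite Cmod_mult, Cmod_R, Rabs_pos_eq; lra.
  - rewrite <- exp_plus, <- exp_0. apply exp_increasing. nra. }
split.
- assert (H := Cmod_triangle (poisson_p m z)
                 (RtoC (exp (- m)) * Cexp (RtoC m * z))%C).
  replace (poisson_p m z + RtoC (exp (- m)) * Cexp (RtoC m * z))%C
    with (RtoC (1 + exp (- m))) in H.
  2:{ rewrite RtoC_plus. unfold poisson_p. ring. }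
  assert (Hp := exp_pos (- m)).
  rewrite Cmod_R, Rabs_pos_eq in H by lra. lra.
- unfold poisson_q. rewrite 2!Cmod_mult, Cmod_R, Rabs_pos_eq by lra.
  assert (H0 := Cmod_ge_0 z).
  assert (H1 := Cmod_ge_0 (RtoC (exp (- m)) * Cexp (RtoC m * z))%C).
  assert (H2 : Cmod z * Cmod (RtoC (exp (- m)) * Cexp (RtoC m * z))%C < 1)
    by nra.
  rewrite Rmult_assoc. nra.
Qed.

Lemma Cmod_lt_minus_neq_0 (x y : C) : Cmod y < Cmod x -> (x - y)%C <> 0%C.
Proof.
intros H E. replace x with y in H; [lra|].
replace x with (x - y + y)%C by ring. rewrite E. ring.
Qed.

(** A negative value at r would force, by the intermediate value theorem, a zero strictly before r,
    hence in [0, 1). This serves as the passage to the limit at 1. *)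
Lemma nonneg_of_no_zero (f : R -> R) :
  continuity f -> 0 < f 0 -> (forall r, 0 <= r < 1 -> f r <> 0) ->
  forall r, 0 <= r <= 1 -> 0 <= f r.
Proof.
intros Hc H0 Hn r Hr.
destruct (Rle_lt_dec 0 (f r)) as [|Hlt]; [assumption|exfalso].
destruct (IVT_cor f 0 r Hc) as [x [Hx Hfx]]; [lra|nra|].
apply (Hn x); [|assumption].
destruct (Req_dec x r) as [->|]; lra.
Qed.

(** * Sufficiency of the inequality *)

Lemma class_S_poisson_F_suff (m k lambda : R) :
  0 < m -> 0 < k -> k <= 1 -> 0 <= lambda < 1 ->
  ((1 - lambda) + k * (1 + lambda)) * m <= 2 * k * exp (- m) ->
  class_S k lambda (poisson_F m).
Proof.
intros hm hk0 hk1 hl Hc.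
split; [now apply poisson_F_class_T|].
intros z Hz.
destruct (poisson_p_q_bounds m z hm Hz) as [Hp Hq].
assert (Hq0 := Cmod_ge_0 (poisson_q m z)).
assert (Hd : (poisson_p m z - RtoC lambda * poisson_q m z)%C <> 0%C).
{ apply Cmod_lt_minus_neq_0. rewrite Cmod_mult, Cmod_R, Rabs_pos_eq by lra.
  assert (lambda * m <= exp (- m)).
  { apply (Rmult_le_reg_l (2 * k)); [lra|].
    (* The excess of (1 - lambda) + k (1 + lambda) over 2 k lambda is (1 - lambda)(1 + k). *)
    assert (0 <= (1 - lambda) * (1 + k) * m)
      by (repeat apply Rmult_le_pos; lra). lra. }
  assert (lambda * Cmod (poisson_q m z) <= lambda * m)
    by (apply Rmult_le_compat_l; lra).
  lra. }
assert (Hs : Cmod (RtoC (1 + lambda) * poisson_q m z)%C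
             < Cmod (2 * poisson_p m z)%C).
{ rewrite !Cmod_mult, !Cmod_R, !Rabs_pos_eq by lra.
  assert ((1 + lambda) * m <= 2 * exp (- m)).
  { apply (Rmult_le_reg_l k); [lra|].
    assert (0 <= (1 - lambda) * m) by (apply Rmult_le_pos; lra). lra. }
  assert ((1 + lambda) * Cmod (poisson_q m z) <= (1 + lambda) * m)
    by (apply Rmult_le_compat_l; lra).
  lra. }
assert (Hn := Cmod_lt_minus_neq_0 _ _ Hs).
assert (Hplus : (quot lambda (poisson_F m) z + 1)%C =
  ((2 * poisson_p m z - RtoC (1 + lambda) * poisson_q m z)
   / (poisson_p m z - RtoC lambda * poisson_q m z))%C).
{ rewrite quot_poisson_F, RtoC_plus by assumption. field. assumption. }
split; [|split].
- intros Hz0. rewrite quot_den_poisson_F. now apply Cmult_neq_0.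
- rewrite Hplus. intros E. apply Hn.
  apply (f_equal (fun x => x *
     (poisson_p m z - RtoC lambda * poisson_q m z)))%C in E.
  rewrite Cmult_0_l in E. rewrite <- E. field. assumption.
- rewrite Hplus, quot_poisson_F by assumption.
  replace (_ / _)%C with (- (RtoC (1 - lambda) * poisson_q m z)
    / (2 * poisson_p m z - RtoC (1 + lambda) * poisson_q m z))%C.
  2:{ rewrite RtoC_minus. field. now split. }
  rewrite Cmod_div, Cmod_opp, Cmod_mult, Cmod_R, Rabs_pos_eq by (assumption || lra).
  assert (Hpos := proj1 (Cmod_gt_0 _) Hn).
  apply (Rmult_lt_reg_r _ _ _ Hpos). unfold Rdiv.
  rewrite Rmult_assoc, Rinv_l, Rmult_1_r by lra.
  (* This gives 2|p| <= |2p - (1 + lambda) q| + (1 + lambda)|q|. The strict inequality finally comes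
     from |p| > e^(-m). *)
  assert (Ht := Cmod_triangle
    (2 * poisson_p m z - RtoC (1 + lambda) * poisson_q m z)%C
    (RtoC (1 + lambda) * poisson_q m z)%C).
  replace (2 * poisson_p m z - RtoC (1 + lambda) * poisson_q m z
           + RtoC (1 + lambda) * poisson_q m z)%C
    with (2 * poisson_p m z)%C in Ht by ring.
  rewrite !(Cmod_mult _ (poisson_q m z)), (Cmod_mult 2), !Cmod_R,
    !Rabs_pos_eq in Ht by lra.
  apply (Rmult_le_compat_l k) in Ht; [|lra].
  assert (((1 - lambda) + k * (1 + lambda)) * Cmod (poisson_q m z)
          <= ((1 - lambda) + k * (1 + lambda)) * m).
  { apply Rmult_le_compat_l; [|lra].
    assert (0 <= k * (1 + lambda)) by (apply Rmult_le_pos; lra). lra. }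
  apply (Rmult_lt_compat_l (2 * k)) in Hp; [|lra].
  lra.
Qed.

(** * Necessity of the inequality, from the real segment [0, 1) *)

Lemma class_S_poisson_F_nec (m k lambda : R) :
  0 < k -> 0 <= lambda < 1 ->
  class_S k lambda (poisson_F m) ->
  ((1 - lambda) + k * (1 + lambda)) * m <= 2 * k * exp (- m).
Proof.
intros hk0 hl [_ HS].
set (p := fun r => 1 + exp (- m) - exp (- m) * exp (m * r)).
set (q := fun r => m * r * (exp (- m) * exp (m * r))).
assert (Hp0 : p 0 = 1) by (unfold p; rewrite Rmult_0_r, exp_0; ring).
assert (Hq0 : q 0 = 0) by (unfold q; ring).
assert (Hcomb : forall a b : R, continuity (fun r => a * p r - b * q r)).
{ intros a b r. apply derivable_continuous_pt. unfold p, q. reg. }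
assert (HR : forall r, 0 <= r < 1 ->
  2 * p r - (1 + lambda) * q r <> 0 /\
  Rabs ((1 - lambda) * q r) < k * Rabs (2 * p r - (1 + lambda) * q r)).
{ intros r Hr.
  assert (Hu : unit_disc (RtoC r)).
  { unfold unit_disc. rewrite Cmod_R, Rabs_pos_eq; lra. }
  destruct (HS _ Hu) as [Hd [Hn Hlt]].
  assert (Ed : (poisson_p m r - RtoC lambda * poisson_q m r)%C
               = RtoC (p r - lambda * q r)).
  { now rewrite poisson_p_RtoC, poisson_q_RtoC, <- RtoC_mult, <- RtoC_minus. }
  assert (Hd' : p r - lambda * q r <> 0).
  (* The condition on [quot_den] excludes the origin, where the value 1 is computed directly. *)
  { destruct (Req_dec r 0) as [->|Hr0].
    - rewrite Hp0, Hq0. lra.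
    - intros E. apply Hd.
      + intros E0. apply Hr0. now apply RtoC_inj.
      + rewrite quot_den_poisson_F, Ed, E. ring. }
  assert (Eq : quot lambda (poisson_F m) r
               = RtoC ((p r - q r) / (p r - lambda * q r))).
  { rewrite quot_poisson_F; rewrite Ed; [|intros E; now apply Hd', RtoC_inj].
    rewrite poisson_p_RtoC, poisson_q_RtoC, <- RtoC_minus, RtoC_div by exact Hd'.
    reflexivity. }
  rewrite Eq in Hn, Hlt.
  rewrite <- RtoC_plus in Hn, Hlt. rewrite <- RtoC_minus in Hlt.
  assert (Hn' : (p r - q r) / (p r - lambda * q r) + 1 <> 0).
  { intros E. apply Hn. now rewrite E. }
  rewrite <- RtoC_div, Cmod_R in Hlt by exact Hn'.
  assert (Hs : 2 * p r - (1 + lambda) * q r <> 0).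
  { intros E. apply Hn'.
    replace ((p r - q r) / (p r - lambda * q r) + 1)
      with ((2 * p r - (1 + lambda) * q r) / (p r - lambda * q r))
      by (field; exact Hd').
    rewrite E. field. exact Hd'. }
  split; [exact Hs|].
  replace (((p r - q r) / (p r - lambda * q r) - 1)
           / ((p r - q r) / (p r - lambda * q r) + 1))
    with (- ((1 - lambda) * q r) / (2 * p r - (1 + lambda) * q r)) in Hlt.
  2:{ field. repeat split; try assumption.
      intros E. apply Hs. lra. }
  rewrite Rabs_div, Rabs_Ropp in Hlt by exact Hs.
  assert (Hpos := Rabs_pos_lt _ Hs).
  apply (Rmult_lt_compat_r _ _ _ Hpos) in Hlt. unfold Rdiv in Hlt.
  rewrite Rmult_assoc, Rinv_l, Rmult_1_r in Hlt by lra. exact Hlt. }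
assert (Hs : forall r, 0 <= r <= 1 -> 0 <= 2 * p r - (1 + lambda) * q r).
{ apply (nonneg_of_no_zero (fun r => 2 * p r - (1 + lambda) * q r)).
  - apply Hcomb.
  - rewrite Hp0, Hq0. lra.
  - intros r Hr. apply (HR r Hr). }
(* The function is k (2p - (1 + lambda) q) - (1 - lambda) q: it is positive on [0, 1) by [HR] and
   [Hs], hence nonnegative at 1. *)
assert (HG : 0 <= 2 * k * p 1 - ((1 - lambda) + k * (1 + lambda)) * q 1).
{ apply (nonneg_of_no_zero
    (fun r => 2 * k * p r - ((1 - lambda) + k * (1 + lambda)) * q r)).
  - apply Hcomb.
  - rewrite Hp0, Hq0. lra.
  - intros r Hr. destruct (HR r Hr) as [_ Hlt].
    rewrite (Rabs_pos_eq (2 * p r - _)) in Hlt by (apply Hs; lra).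
    assert (Ha := Rle_abs ((1 - lambda) * q r)). nra.
  - lra. }
(* At 1, p is e^(-m) and q is m. *)
unfold p, q in HG. rewrite Rmult_1_r, <- exp_plus, Rplus_opp_l, exp_0 in HG.
lra.
Qed.

Theorem theorem2p1 (m k lambda : R)
  (hm : 0 < m) (hk0 : 0 < k) (hk1 : k <= 1)
  (hl0 : 0 <= lambda) (hl1 : lambda < 1) :
  class_S k lambda (poisson_F m) <->
  ((1 - lambda) + k * (1 + lambda)) * m * exp m <= 2 * k.
Proof.
(* Multiplication by e^m > 0 turns the bound by 2 k e^(-m) of the two implications into the stated
   one. *)
assert (He : exp (- m) * exp m = 1)
  by (rewrite <- exp_plus, Rplus_opp_l; apply exp_0).
assert (Hp := exp_pos m).
split; intros H.
- apply class_S_poisson_F_nec in H; [|assumption|lra].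
  apply (Rmult_le_compat_r (exp m)) in H; [|lra].
  rewrite (Rmult_assoc (2 * k)), He in H. lra.
- apply class_S_poisson_F_suff; try assumption; [lra|].
  apply (Rmult_le_reg_r (exp m)); [assumption|].
  rewrite (Rmult_assoc (2 * k)), He. lra.
Qed.
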